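(* Let $\mathcal{C}$ be a bounded above graded poset and let $H:\mathcal{C}\to\mathrm{Ab}$ be a functor. If $H$ is pseudo-injective, then $H$ is $\varprojlim$-acyclic, i.e. $\varprojlim^j H=0$ for all $j\ge 1$.
   Context: A poset is regarded as a category with exactly one arrow $p\to p'$ when $p\le p'$ and none otherwise. For $p<p'$, $p$ precedes $p'$ if $p\le p''\le p'$ implies $p''=p$ or $p''=p'$. A graded poset is a poset together with an (increasing) degree function $\deg:\mathrm{Ob}(\mathcal{C})\to\mathbb{Z}$ which is strictly order preserving and such that $\deg(p')=\deg(p)+1$ whenever $p$ precedes $p'$. It is bounded above if the set of values of $\deg$ has an upper bound. The degree of an arrow $p\to p'$ is $|\deg(p')-\deg(p)|$. $\varprojlim^j:\mathrm{Ab}^{\mathcal{C}}\to\mathrm{Ab}$ is the $j$-th right derived functor of the limit functor. For $H:\mathcal{C}\to\mathrm{Ab}$ and an object $i_0$, $\operatorname{Ker}(i_0)=\bigcap_{\alpha:i_0\to i,\ \alpha\ne 1_{i_0}}\ker H(\alpha)$ (equal to $H(i_0)$ if there is no such $\alpha$). $H$ is pseudo-injective if for every integer $d\ge 0$ the following holds: for any object $i_0$, any family of pairwise different objects $\{i_j\}_{j\in J}$, arrows $\alpha_j:i_0\to i_j$ with $\deg(\alpha_j)=d$ and elements $x_j\in\operatorname{Ker}(i_j)$ ($j\in J$), there is $y\in H(i_0)$ with $H(\alpha_j)(y)=x_j$ for every $j\in J$. *)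

(* Defs.v *)
From HB Require Import structures.
From mathcomp Require Import all_boot all_order all_algebra.
From mathcomp Require Import boolp classical_sets functions.

Set Implicit Arguments.
Unset Strict Implicit.
Unset Printing Implicit Defensive.

Import Order.TTheory GRing.Theory Num.Theory.
Local Open Scope classical_set_scope.
Local Open Scope ring_scope.

(* MathComp with the classical axioms of mathcomp.classical.  Abelian groups are
   [zmodType]s. *)

Definition additive_of (U V : zmodType) (f : U -> V) (fB : zmod_morphism f) :
  {additive U -> V} := HB.pack f (GRing.isZmodMorphism.Build U V f fB).

(* The product of a family of abelian groups. *)
Definition dprod (I : Type) (A : I -> zmodType) : Type := forall i, A i.

Section DProd.
Context (I : Type) (A : I -> zmodType).
Implicit Types x y z : dprod A.

HB.instance Definition _ := gen_eqMixin (dprod A).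
HB.instance Definition _ := gen_choiceMixin (dprod A).

Let zero : dprod A := fun=> 0.
Let opp x : dprod A := fun i => - x i.
Let add x y : dprod A := fun i => x i + y i.

Let addA : associative add.
Proof. by move=> x y z; apply: functional_extensionality_dep => i; apply: addrA. Qed.
Let addC : commutative add.
Proof. by move=> x y; apply: functional_extensionality_dep => i; apply: addrC. Qed.
Let add0 : left_id zero add.
Proof. by move=> x; apply: functional_extensionality_dep => i; apply: add0r. Qed.
Let addN : left_inverse zero opp add.
Proof. by move=> x; apply: functional_extensionality_dep => i; apply: addNr. Qed.

HB.instance Definition _ := GRing.isZmodule.Build (dprod A) addA addC add0 addN.

Lemma dprodDE x y i : (x + y) i = x i + y i. Proof. by []. Qed.
Lemma dprodNE x i : (- x) i = - x i. Proof. by []. Qed.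
Lemma dprod0E i : (0 : dprod A) i = 0. Proof. by []. Qed.

End DProd.

Section KernelImage.
Context (U V : zmodType) (f : {additive U -> V}).

Definition addker : {pred U} := fun x => f x == 0.
Definition addim : {pred V} := fun y => `[< exists x, f x = y >].

Lemma addker_zmod_closed : zmod_closed addker.
Proof.
split=> [|x y]; rewrite !unfold_in ?raddf0 // => /eqP fx /eqP fy.
by rewrite raddfB fx fy subrr.
Qed.
HB.instance Definition _ := GRing.isZmodClosed.Build U addker addker_zmod_closed.

Lemma addim_zmod_closed : zmod_closed addim.
Proof.
split=> [|x y]; rewrite !unfold_in; first by apply/asboolP; exists 0; rewrite raddf0.
by move=> /asboolP[a <-] /asboolP[b <-]; apply/asboolP; exists (a - b); rewrite raddfB.
Qed.
HB.instance Definition _ := GRing.isZmodClosed.Build V addim addim_zmod_closed.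

Definition kernel := {x : U | x \in addker}.
HB.instance Definition _ := SubChoice.on kernel.
HB.instance Definition _ := [SubChoice_isSubZmodule of kernel by <:].

Definition cokernel := Quotient.quot addim.
HB.instance Definition _ := GRing.Zmodule.on cokernel.
End KernelImage.

(* [p <= q] is a boolean, so there is at most one arrow from p to q. *)
Record abfunctor d (C : porderType d) := ABFunctor {
  fobj :> C -> zmodType;
  farr : forall p q, (p <= q)%O -> {additive fobj p -> fobj q};
  farr_id : forall p (pp : (p <= p)%O) x, farr pp x = x;
  farr_comp : forall p q r (pq : (p <= q)%O) (qr : (q <= r)%O) (pr : (p <= r)%O) x,
    farr pr x = farr qr (farr pq x) }.

Record nattrans d (C : porderType d) (F G : abfunctor C) := NatTrans {
  ncomp :> forall p, {additive F p -> G p};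
  naturality : forall p q (pq : (p <= q)%O) x,
    ncomp q (farr F pq x) = farr G pq (ncomp p x) }.

Section Limit.
Context d (C : porderType d).
Implicit Types F G : abfunctor C.

(* The limit of F is the subgroup of compatible families in the product. *)
Definition compatible F : {pred dprod F} :=
  fun x => `[< forall p q (pq : (p <= q)%O), farr F pq (x p) = x q >].

Lemma compatible_zmod_closed F : zmod_closed (@compatible F).
Proof.
split=> [|x y]; rewrite !unfold_in.
  by apply/asboolP=> p q pq; rewrite !dprod0E raddf0.
move=> /asboolP cx /asboolP cy; apply/asboolP=> p q pq.
by rewrite !dprodDE !dprodNE raddfB cx cy.
Qed.
HB.instance Definition _ F :=
  GRing.isZmodClosed.Build (dprod F) (@compatible F) (compatible_zmod_closed F).

Definition limit F := {x : dprod F | x \in @compatible F}.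
HB.instance Definition _ F := SubChoice.on (limit F).
HB.instance Definition _ F := [SubChoice_isSubZmodule of (limit F) by <:].

Fact limit_map_subproof F G (f : nattrans F G) (x : limit F) :
  (fun p => f p (val x p) : G p) \in @compatible G.
Proof.
rewrite unfold_in; apply/asboolP=> p q pq; rewrite -naturality.
by have := valP x; rewrite unfold_in => /asboolP ->.
Qed.

Definition limit_fun F G (f : nattrans F G) (x : limit F) : limit G :=
  exist (fun y : dprod G => y \in @compatible G) _ (limit_map_subproof f x).

Fact limit_fun_is_zmod_morphism F G (f : nattrans F G) :
  zmod_morphism (limit_fun f).
Proof.
move=> x y; apply: val_inj => /=; apply: functional_extensionality_dep => p.
by rewrite dprodDE dprodNE raddfB.
Qed.

Definition limit_map F G (f : nattrans F G) : {additive limit F -> limit G} :=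
  additive_of (limit_fun_is_zmod_morphism f).

End Limit.

Section Cohomology.
Context (A : nat -> zmodType) (dA : forall n, {additive A n -> A n.+1}).

Definition coboundary n : {pred A n} :=
  match n return {pred A n} with
  | 0 => fun x => x == 0
  | m.+1 => addim (dA m)
  end.

Definition cocycle n := kernel (dA n).
HB.instance Definition _ n := GRing.SubZmodule.on (cocycle n).

(* H^n = ker d_n / im d_(n-1), with im d_(-1) = 0. *)
Definition exact_cocycle n : {pred cocycle n} := fun z => val z \in @coboundary n.

Lemma exact_cocycle_zmod_closed n : zmod_closed (@exact_cocycle n).
Proof.
suff [B0 BB] : zmod_closed (@coboundary n).
  by split=> [|x y]; rewrite !unfold_in ?raddf0 ?raddfB //; exact: BB.
case: n => [|n]; last exact: addim_zmod_closed.
by split=> [|x y]; rewrite !unfold_in // => /eqP -> /eqP ->; rewrite subrr.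
Qed.
HB.instance Definition _ n := GRing.isZmodClosed.Build (cocycle n)
  (@exact_cocycle n) (@exact_cocycle_zmod_closed n).

Definition cohomology n := Quotient.quot (@exact_cocycle n).
HB.instance Definition _ n := GRing.Zmodule.on (cohomology n).

End Cohomology.

Section DerivedLimit.
Context d (C : porderType d).
Implicit Types F G I H : abfunctor C.

(* Monomorphisms and exactness in the category of functors are objectwise. *)
Definition nat_mono F G (m : nattrans F G) := forall p, injective (m p).

Definition injective_functor I := forall F G (m : nattrans F G) (f : nattrans F I),
  nat_mono m -> exists g : nattrans G I, forall p x, g p (m p x) = f p x.

Record injective_resolution H := InjectiveResolution {
  res_obj : nat -> abfunctor C;
  res_d : forall n, nattrans (res_obj n) (res_obj n.+1);
  res_aug : nattrans H (res_obj 0%N);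
  res_injective : forall n, injective_functor (res_obj n);
  res_mono : nat_mono res_aug;
  res_exact0 : forall p y, res_d 0%N p y = 0 <-> exists x, res_aug p x = y;
  res_exact : forall n p y,
    res_d n.+1 p y = 0 <-> exists x, res_d n p x = y }.

(* The j-th right derived functor of the limit at H, computed from an injective
   resolution R of H; up to isomorphism it does not depend on R.  Every H has an
   injective resolution: see [standard_resolution]. *)
Definition derived_limit H (R : injective_resolution H) (j : nat) : zmodType :=
  cohomology (fun n => limit_map (res_d R n)) j.

Definition lim_acyclic H := forall (R : injective_resolution H) (j : nat),
  (1 <= j)%N -> forall x : derived_limit R j, x = 0.

End DerivedLimit.

Section Graded.
Context d (C : porderType d).
Implicit Types (deg : C -> int) (H : abfunctor C).

Definition precedes (p q : C) :=
  (p < q)%O /\ forall r : C, (p <= r)%O -> (r <= q)%O -> r = p \/ r = q.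

Definition graded deg :=
  (forall p q : C, (p < q)%O -> deg p < deg q) /\
  (forall p q : C, precedes p q -> deg q = deg p + 1).

Definition bounded_above deg := exists N : int, forall p, deg p <= N.

Definition arrow_deg deg (p q : C) : nat := `|deg q - deg p|%N.

(* The arrow [p <= q] is an identity exactly when q = p. *)
Definition Ker H (p : C) : set (H p) :=
  fun x => forall q (pq : (p <= q)%O), q != p -> farr H pq x = 0.

Definition pseudo_injective deg H :=
  forall (n : nat) (p : C) (J : Type) (i : J -> C) (a : forall j, (p <= i j)%O)
    (x : forall j, H (i j)),
    injective i -> (forall j, arrow_deg deg p (i j) = n) ->
    (forall j, Ker (x j)) ->
    exists y : H p, forall j, farr H (a j) y = x j.

End Graded.

(* The category of functors has enough injectives: QZ is the injective group Q/Z,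
   [inj_hull A] a product of copies of it containing A, and [cofree J] the right
   Kan extension to C of a family J of groups indexed by the objects of C. *)

Section DivisibleExtension.
Context (G D : zmodType).
Implicit Types S : set (G * D).

Definition hom_graph S := (forall a b, S a -> S b -> S (a - b)) /\
  (forall y, S (0, y) -> y = 0).

Lemma hom_graph_extend S (g : G) :
    (forall (y : D) n, (0 < n)%N -> exists z, z *+ n = y) ->
    hom_graph S -> S 0 ->
  exists z : D, hom_graph
    [set a | exists b k, S b /\ a = (b.1 + g *~ k, b.2 + z *~ k)].
Proof.
move=> divD [SB S0] S00.
have SN a : S a -> S (- a) by rewrite -sub0r; apply: SB.
have SD a b : S a -> S b -> S (a + b).
  by move=> Sa Sb; rewrite -[b]opprK; apply: SB => //; apply: SN.
have SMn a n : S a -> S (a *+ n).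
  by move=> Sa; elim: n => [|n IHn]; rewrite ?mulr0n // mulrS; apply: SD.
have SMz a (k : int) : S a -> S (a *~ k).
  by case: k => n Sa; rewrite ?NegzE ?mulrNz -pmulrn; [|apply: SN]; apply: SMn.
have mul_pair (x : G) (y : D) (k : int) : (x, y) *~ k = (x *~ k, y *~ k).
  by rewrite [LHS]surjective_pairing; congr pair; exact: raddfMz.
pose P n := `[< (0 < n)%N /\ exists y, S (g *+ n, y) >].
suff [z zP] : exists z : D, forall k y, S (g *~ k, y) -> z *~ k = y.
  exists z; split.
    move=> _ _ [b [k [Sb ->]]] [b' [k' [Sb' ->]]].
    exists (b - b'), (k - k'); split; first exact: SB.
    by congr pair; rewrite /= mulrzBr opprD addrACA.
  move=> y [[b1 b2] [k [Sb [/esym/eqP]]]] /=.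
  rewrite addrC addr_eq0 => /eqP gk ->.
  by rewrite (zP k (- b2)) ?subrr // gk; apply: (SN _ Sb).
have [exP|noP] := pselect (exists n, P n); last first.
  exists 0 => k y; case: (eqVneq k 0) => [->|k0].
    by rewrite !mulr0z => /S0 ->.
  move=> Sk; case: noP; exists `|k|%N; apply/asboolP; split; first by rewrite absz_gt0.
  case: k k0 Sk => n k0 Sk; first by exists y.
  by exists (- y); have := SN _ Sk; rewrite NegzE mulrNz /=; congr (S (_, _)); rewrite /= opprK.
case: (ex_minnP exP) => n /asboolP[n_gt0 [y Sy]] nmin.
have [z zn] := divD y n n_gt0; exists z => k y' Sk.
have kE := divz_eq k n.
pose q := (k %/ n)%Z; pose r := (k %% n)%Z; rewrite -/q -/r in kE.
have r_ge0 : 0 <= r by apply: modz_ge0; rewrite eqz_nat -lt0n.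
have r_lt : r < n by apply: ltz_pmod.
have Sr : S (g *~ r, y' - y *~ q).
  have := SB _ _ Sk (SMz _ q Sy); rewrite mul_pair; congr (S (_, _)); rewrite /=.
  by rewrite kE mulrzDr mulrC mulrzA addrAC pmulrn subrr add0r.
have r0 : r = 0.
  move: r_ge0 r_lt Sr; case: (r) => // m _; rewrite ltz_nat => mn Sm.
  case: m mn Sm => // m mn Sm; suff : (n <= m.+1)%N by rewrite leqNgt mn.
  by apply: nmin; apply/asboolP; split=> //; exists (y' - y *~ q).
move: Sr; rewrite r0 mulr0z => /S0 /eqP; rewrite subr_eq0 => /eqP ->.
by rewrite kE r0 addr0 mulrC mulrzA -pmulrn zn.
Qed.

Lemma divisible_extend S :
    (forall (y : D) n, (0 < n)%N -> exists z, z *+ n = y) ->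
    hom_graph S -> S 0 ->
  exists f : {additive G -> D}, forall a, S a -> f a.1 = a.2.
Proof.
move=> divD Sg S0.
pose P (A : set (G * D)) := hom_graph A /\ (A !=set0 -> S `<=` A).
have [F FP totF|A [[Ag AS] Amax]] := @Zorn_bigcup _ P.
  split; first split.
  - move=> a b [X FX Xa] [Y FY Yb].
    have [XY|YX] := totF _ _ FX FY.
      by exists Y => //; apply: (FP _ FY).1.1 => //; apply: XY.
    by exists X => //; apply: (FP _ FX).1.1 => //; apply: YX.
  - by move=> y [X FX Xy]; apply: (FP _ FX).1.2.
  - move=> [a [X FX Xa]] b Sb; exists X => //; apply: (FP _ FX).2 => //.
    by exists a.
have {}AS : S `<=` A.
  apply: AS; apply: contrapT => A0; apply: (Amax S); last by split=> [|_ a].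
  split; last by move=> /(_ _ S0) A0'; apply: A0; exact: ex_intro A0'.
  by move=> a Aa; case: A0; exists a.
have A0 : A 0 by apply: AS.
have totA g : exists y, A (g, y).
  have [z Bg] := hom_graph_extend g divD Ag A0.
  set B := (X in hom_graph X) in Bg.
  have AB : A `<=` B.
    by move=> [a b] Aab; exists (a, b), 0; rewrite !mulr0z !addr0.
  have Bz : B (g, z) by exists 0, 1; rewrite !add0r.
  exists z; apply: contrapT => nA; apply: (Amax B).
    by split=> // /(_ _ Bz).
  by split=> // _; apply: subset_trans AB.
have [f fP] := choice totA.
have funA g y y' : A (g, y) -> A (g, y') -> y = y'.
  move=> Ay Ay'; apply/eqP; rewrite -subr_eq0; apply/eqP; apply: Ag.2.
  by have := Ag.1 _ _ Ay Ay'; congr (A (_, _)); rewrite /= subrr.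
have fB : zmod_morphism f.
  by move=> x y; apply: funA (fP _) _; apply: (Ag.1 _ _ (fP x) (fP y)).
by exists (additive_of fB) => -[a b] /AS /=; apply: funA.
Qed.

End DivisibleExtension.

Section CokernelTheory.
Context (U V : zmodType) (f : {additive U -> V}).

Definition coker_pi_fun (y : V) : cokernel f := \pi_(cokernel f)%qT y.

Fact coker_pi_is_zmod_morphism : zmod_morphism coker_pi_fun.
Proof. by move=> x y; rewrite /coker_pi_fun !piE. Qed.

Definition coker_pi : {additive V -> cokernel f} :=
  additive_of coker_pi_is_zmod_morphism.

Lemma coker_pi_eq0 y : coker_pi y = 0 <-> exists x, f x = y.
Proof.
rewrite -[0](raddf0 coker_pi); split.
  move=> /eqP; rewrite -[X in is_true X]/(_ == _ %[mod cokernel f])%qT.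
  by rewrite -Quotient.idealrBE subr0 unfold_in => /asboolP.
move=> yf; apply/eqP; rewrite -[X in is_true X]/(_ == _ %[mod cokernel f])%qT.
by rewrite -Quotient.idealrBE subr0 unfold_in; apply/asboolP.
Qed.

Lemma coker_pi_surj z : exists y, coker_pi y = z.
Proof. by exists (repr z); apply: reprK. Qed.

Context (W : zmodType) (g : {additive V -> W}) (gf : forall x, g (f x) = 0).

Let lift_fun (z : cokernel f) : W := g (repr z).

Let lift_funE y : lift_fun (coker_pi y) = g y.
Proof.
apply/eqP; rewrite -subr_eq0 -raddfB.
have /coker_pi_eq0[x <-] : coker_pi (repr (coker_pi y) - y) = 0.
  by rewrite raddfB; apply/eqP; rewrite subr_eq0; apply/eqP; apply: reprK.
by rewrite gf.
Qed.

Fact coker_lift_is_zmod_morphism : zmod_morphism lift_fun.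
Proof.
move=> z z'; have [y <-] := coker_pi_surj z; have [y' <-] := coker_pi_surj z'.
by rewrite -raddfB !lift_funE raddfB.
Qed.

Definition coker_lift : {additive cokernel f -> W} :=
  additive_of coker_lift_is_zmod_morphism.

Lemma coker_liftE y : coker_lift (coker_pi y) = g y.
Proof. exact: lift_funE. Qed.

End CokernelTheory.

Definition QZ : zmodType := cokernel (intr : {additive int -> rat}).

Lemma QZ_divisible (y : QZ) n : (0 < n)%N -> exists z, z *+ n = y.
Proof.
move=> n_gt0; have [x <-] := coker_pi_surj y.
exists (coker_pi _ (x / n%:R)); rewrite -raddfMn -[X in coker_pi _ X = _]mulr_natr divfK //.
by rewrite pnatr_eq0 -lt0n.
Qed.

Lemma QZ_char (A : zmodType) (a : A) : a <> 0 ->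
  exists2 c : QZ, c <> 0 & forall k : int, a *~ k = 0 -> c *~ k = 0.
Proof.
move=> a0; pose pi := coker_pi (intr : {additive int -> rat}).
suff [n n_gt1 nP] : exists2 n, (1 < n)%N &
    forall k : int, a *~ k = 0 -> (n %| k)%Z.
  have n0 : n%:R != 0 :> rat by rewrite pnatr_eq0 -lt0n ltnW.
  exists (pi (n%:R^-1)) => [/coker_pi_eq0[m nm]|k /nP/dvdzP[q ->]].
    have : (m * n)%:~R = 1%:~R :> rat by rewrite intrM nm mulVf.
    move=> /intr_inj mn; have : (n %| 1)%Z by apply/dvdzP; exists m.
    by rewrite dvdz1 /= => /eqP n1; rewrite n1 in n_gt1.
  rewrite mulrC mulrzA -pmulrn -raddfMn -[X in pi X]mulr_natr mulVf //.
  rewrite -raddfMz; apply/coker_pi_eq0; by exists q.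
have [exP|noP] := pselect (exists n, (0 < n)%N && (a *+ n == 0)).
  case: (ex_minnP exP) => n /andP[n_gt0 /eqP an] nmin.
  exists n; first by case: n n_gt0 an {nmin} => [|[|n]] // _ /a0.
  move=> k ak; apply/dvdz_mod0P; have kE := divz_eq k n.
  have r_ge0 : 0 <= (k %% n)%Z by apply: modz_ge0; rewrite eqz_nat -lt0n.
  have r_lt : (k %% n)%Z < n by apply: ltz_pmod.
  have : a *~ (k %% n)%Z = 0.
    by move: ak; rewrite {1}kE mulrzDr mulrC mulrzA -pmulrn an mul0rz add0r.
  move: r_ge0 r_lt; case: (k %% n)%Z => // -[//|m] _; rewrite ltz_nat => mn am.
  by have : (n <= m.+1)%N by [apply: nmin; apply/eqP]; rewrite leqNgt mn.
exists 2 => // k; case: (eqVneq k 0) => [->//|k0 ak]; case: noP; exists `|k|%N.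
rewrite absz_gt0 k0 /=; case: k {k0} ak => n; rewrite ?NegzE ?mulrNz => /eqP //.
by rewrite oppr_eq0.
Qed.

Definition injective_group (D : zmodType) :=
  forall (F G : zmodType) (m : {additive F -> G}) (f : {additive F -> D}),
    injective m -> exists g : {additive G -> D}, forall x, g (m x) = f x.

Lemma QZ_injective : injective_group QZ.
Proof.
move=> F G m f m_inj.
have [|||g gP] := @divisible_extend G QZ [set a | exists x, a = (m x, f x)].
- exact: QZ_divisible.
- split=> [_ _ [x ->] [y ->]|y [x [/esym mx ->]]].
    by exists (x - y); rewrite !raddfB.
  by move: mx; rewrite -[0](raddf0 m) => /m_inj ->; rewrite raddf0.
- by exists 0; rewrite !raddf0.
by exists g => x; apply: (gP (m x, f x)); exists x.
Qed.

Definition inj_hull (A : zmodType) : zmodType := ({additive A -> QZ} -> QZ).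

Lemma inj_hull_injective (A : zmodType) : injective_group (inj_hull A).
Proof.
move=> F G m f m_inj.
have fB (h : {additive A -> QZ}) : zmod_morphism (fun x => f x h : QZ).
  by move=> x y; rewrite raddfB.
have /choice[g gP] h := QZ_injective (additive_of (fB h)) m_inj.
have gB : zmod_morphism (fun y => (fun h => g h y) : inj_hull A).
  by move=> x y; apply: funext => h; rewrite raddfB.
by exists (additive_of gB) => x; apply: funext => h; apply: gP.
Qed.

Fact hull_emb_is_zmod_morphism (A : zmodType) :
  zmod_morphism (fun a : A => (fun h => h a) : inj_hull A).
Proof. by move=> x y; apply: funext => h; rewrite raddfB. Qed.

Definition hull_emb (A : zmodType) : {additive A -> inj_hull A} :=
  additive_of (@hull_emb_is_zmod_morphism A).

Lemma hull_emb_inj (A : zmodType) : injective (hull_emb A).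
Proof.
apply: raddf_inj => a ha; apply: contrapT => /[dup] a0 /QZ_char[c c0 cP].
have [|||h hP] := @divisible_extend A QZ [set b | exists k, b = (a *~ k, c *~ k)].
- exact: QZ_divisible.
- split=> [_ _ [k ->] [l ->]|y [k [/esym /cP ak ->]]] //.
  by exists (k - l); rewrite !mulrzBr.
- by exists 0; rewrite !mulr0z.
have hac : h a = c by apply: (hP (a, c)); exists 1; rewrite !mulr1z.
by apply: c0; rewrite -hac; apply: (congr1 (fun z => z h) ha).
Qed.

Section Resolution.
Context d (C : porderType d).
Implicit Types F G H : abfunctor C.

Section Cofree.
Context (J : C -> zmodType).

Definition cofree_obj (p : C) : zmodType :=
  dprod (fun i : {q : C | (p <= q)%O} => J (sval i)).

Definition cofree_arr_fun p q (pq : (p <= q)%O) (x : cofree_obj p) : cofree_obj q :=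
  fun i => x (exist (fun r => (p <= r)%O) (sval i) (le_trans pq (proj2_sig i))).

Fact cofree_arr_is_zmod_morphism p q (pq : (p <= q)%O) :
  zmod_morphism (cofree_arr_fun pq).
Proof. by []. Qed.

Fact cofree_id p (pp : (p <= p)%O) x : cofree_arr_fun pp x = x.
Proof.
apply: functional_extensionality_dep => -[q pq]; rewrite /cofree_arr_fun /=.
by rewrite (bool_irrelevance (le_trans _ _) pq).
Qed.

Fact cofree_comp p q r (pq : (p <= q)%O) (qr : (q <= r)%O) (pr : (p <= r)%O) x :
  cofree_arr_fun pr x = cofree_arr_fun qr (cofree_arr_fun pq x).
Proof.
apply: functional_extensionality_dep => -[s rs]; rewrite /cofree_arr_fun /=.
by congr (x (exist _ _ _)); apply: bool_irrelevance.
Qed.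

Definition cofree : abfunctor C := @ABFunctor d C cofree_obj
  (fun p q pq => additive_of (@cofree_arr_is_zmod_morphism p q pq))
  cofree_id cofree_comp.

Lemma cofree_injective : (forall p, injective_group (J p)) -> injective_functor cofree.
Proof.
move=> Jinj F G m f m_mono.
pose refl (p : C) : {q : C | (p <= q)%O} := exist _ p (lexx p).
have fB p : zmod_morphism (fun x => f p x (refl p) : J p).
  by move=> x y; rewrite raddfB.
have gex p : exists g : {additive G p -> J p}, forall x, g (m p x) = f p x (refl p).
  exact: (Jinj p _ _ _ (additive_of (fB p)) (m_mono p)).
pose g p := projT1 (cid (gex p)).
have gE p x : g p (m p x) = f p x (refl p) by rewrite /g; case: cid.
have hB p : zmod_morphism
    (fun y => (fun i => g (sval i) (farr G (proj2_sig i) y)) : cofree_obj p).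
  by move=> x y; apply: functional_extensionality_dep => i; rewrite !raddfB.
have hN p q (pq : (p <= q)%O) x :
    additive_of (hB q) (farr G pq x) = farr cofree pq (additive_of (hB p) x).
  apply: functional_extensionality_dep => i /=; rewrite /cofree_arr_fun /=.
  by rewrite -(farr_comp pq (proj2_sig i) (le_trans pq (proj2_sig i))).
exists (@NatTrans d C G cofree (fun p => additive_of (hB p)) hN) => p x; apply: functional_extensionality_dep => -[q pq] /=.
rewrite -naturality gE naturality /= /cofree_arr_fun /=.
by rewrite (bool_irrelevance (le_trans _ _) pq).
Qed.
End Cofree.

Section Embedding.
Context (F : abfunctor C).

Definition inj_env := cofree (fun p => inj_hull (F p)).

Definition env_emb_fun p (x : F p) : inj_env p :=
  fun i => hull_emb (F (sval i)) (farr F (proj2_sig i) x).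

Fact env_emb_is_zmod_morphism p : zmod_morphism (@env_emb_fun p).
Proof.
by move=> x y; apply: functional_extensionality_dep => i; rewrite /env_emb_fun !raddfB.
Qed.

Fact env_emb_natural p q (pq : (p <= q)%O) x :
  additive_of (@env_emb_is_zmod_morphism q) (farr F pq x) =
  farr inj_env pq (additive_of (@env_emb_is_zmod_morphism p) x).
Proof.
apply: functional_extensionality_dep => i /=.
by rewrite /cofree_arr_fun /env_emb_fun -(farr_comp pq (proj2_sig i) (le_trans pq (proj2_sig i))).
Qed.

Definition env_emb : nattrans F inj_env := NatTrans env_emb_natural.

Lemma env_emb_mono : nat_mono env_emb.
Proof.
move=> p; apply: raddf_inj => x ex; apply: (@hull_emb_inj (F p)).
rewrite raddf0 -(farr_id (lexx p) x).
exact: (congr1 (fun z : inj_env p => z (exist _ p (lexx p))) ex).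
Qed.
End Embedding.

Section CokernelFunctor.
Context F G (m : nattrans F G).

Let push p q (pq : (p <= q)%O) : {additive G p -> cokernel (m q)} :=
  coker_pi (m q) \o farr G pq.

Fact coker_arr_subproof p q (pq : (p <= q)%O) x : push pq (m p x) = 0.
Proof. by apply/coker_pi_eq0; exists (farr F pq x); rewrite naturality. Qed.

Definition coker_arr p q (pq : (p <= q)%O) :
    {additive cokernel (m p) -> cokernel (m q)} :=
  coker_lift (coker_arr_subproof pq).

Fact coker_arrE p q (pq : (p <= q)%O) y :
  coker_arr pq (coker_pi (m p) y) = coker_pi (m q) (farr G pq y).
Proof. exact: coker_liftE. Qed.

Fact coker_arr_id p (pp : (p <= p)%O) x : coker_arr pp x = x.
Proof. by have [y <-] := coker_pi_surj x; rewrite coker_arrE farr_id. Qed.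

Fact coker_arr_comp p q r (pq : (p <= q)%O) (qr : (q <= r)%O) (pr : (p <= r)%O) x :
  coker_arr pr x = coker_arr qr (coker_arr pq x).
Proof.
by have [y <-] := coker_pi_surj x; rewrite !coker_arrE (farr_comp pq qr pr).
Qed.

Definition coker_functor : abfunctor C := ABFunctor coker_arr_id coker_arr_comp.

Definition coker_proj : nattrans G coker_functor :=
  @NatTrans d C G coker_functor (fun p => coker_pi (m p))
    (fun p q pq x => esym (coker_arrE pq x)).
End CokernelFunctor.

Section Splice.
Context F G H (f : nattrans F G) (g : nattrans G H).

Definition nat_comp_at p : {additive F p -> H p} := g p \o f p.

Fact nat_comp_natural p q (pq : (p <= q)%O) x :
  nat_comp_at q (farr F pq x) = farr H pq (nat_comp_at p x).
Proof. by rewrite /nat_comp_at /= !naturality. Qed.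

Definition nat_comp : nattrans F H := NatTrans nat_comp_natural.
End Splice.

Context (H : abfunctor C).

Fixpoint syzygy n : abfunctor C :=
  if n is n'.+1 then coker_functor (env_emb (syzygy n')) else H.

Definition env_d n : nattrans (inj_env (syzygy n)) (inj_env (syzygy n.+1)) :=
  nat_comp (coker_proj (env_emb (syzygy n))) (env_emb (syzygy n.+1)).

Fact env_d_eq0 n p y :
  env_d n p y = 0 <-> exists x, env_emb (syzygy n) p x = y.
Proof.
rewrite -coker_pi_eq0; split=> [|y0].
  by rewrite -[0](raddf0 (env_emb (syzygy n.+1) p)) => /env_emb_mono.
by rewrite -[env_d n p y]/(env_emb (syzygy n.+1) p (coker_pi _ y)) y0 raddf0.
Qed.

Fact env_d_im n p y :
  env_d n.+1 p y = 0 <-> exists x, env_d n p x = y.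
Proof.
rewrite env_d_eq0; split=> [[x <-]|[x <-]]; last by exists (coker_pi _ x).
by have [z <-] := coker_pi_surj x; exists z.
Qed.

Definition standard_resolution : injective_resolution H :=
  @InjectiveResolution d C H (fun n => inj_env (syzygy n)) env_d
    (env_emb H)
    (fun n => cofree_injective (fun p => @inj_hull_injective (syzygy n p)))
    (@env_emb_mono H) (@env_d_eq0 0%N) env_d_im.

End Resolution.

(* Main.v *)
Require Import Defs.
From mathcomp Require Import all_boot all_order all_algebra.
From mathcomp Require Import boolp classical_sets functions.
From mathcomp Require Import zify.

(* Functors on C are sheaves for the topology of upper sets, and lim is global
   sections, so it is enough that pseudo-injective functors are flasque and that
   flasqueness passes along a resolution.  As degrees are bounded above, < can be
   inducted on from the top, and flasqueness reduces to extending to p the sections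
   over {q | p < q}.  For a pseudo-injective functor, such a section is matched by
   an element of H p one degree at a time, downwards from the top: the error in the
   next degree lies in Ker, so it can be corrected, and by interpolation of degrees
   the correction vanishes in all higher degrees. *)

Set Implicit Arguments.
Unset Strict Implicit.
Unset Printing Implicit Defensive.

Import Order.TTheory GRing.Theory Num.Theory.
Local Open Scope classical_set_scope.
Local Open Scope ring_scope.

Section Extension.
Context d (C : porderType d).
Implicit Types F G : abfunctor C.

(** When [U] is an upper set, these are the sections over [U]; [s] is total for convenience and its
    values outside [U] are junk. *)
Definition section_over F (U : set C) (s : dprod F) :=
  forall q r (qr : (q <= r)%O), U q -> farr F qr (s q) = s r.

Definition above (p : C) : set C := [set q | (p < q)%O].

(* [K] stands for a subfunctor of [F]. *)
Definition extensible F (K : forall p, set (F p)) :=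
  forall p (s : dprod F), section_over (above p) s ->
    (forall q, (p < q)%O -> K q (s q)) ->
  exists2 y, K p y & forall q (pq : (p <= q)%O), (p < q)%O -> farr F pq y = s q.

Lemma cofree_extensible (J : C -> zmodType) :
  extensible (F := cofree J) (fun=> setT).
Proof.
move=> p s sP _.
(* The components strictly above [p] are forced; the one at [p] itself is free, hence 0. *)
exists (fun i => if (p < sval i)%O then s (sval i) (exist _ (sval i) (lexx _)) else 0) => //.
move=> q pq p_lt_q; apply: functional_extensionality_dep => -[r qr] /=.
rewrite /cofree_arr_fun /= (lt_le_trans p_lt_q qr) -(sP _ _ qr p_lt_q) /=.
by rewrite /cofree_arr_fun /=; congr (s q (exist _ _ _)); apply: bool_irrelevance.
Qed.

(** An injective functor is a retract of the cofree functor [inj_env F], and extensibility passes to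
    retracts. *)
Lemma injective_extensible F : injective_functor F ->
  extensible (F := F) (fun=> setT).
Proof.
move=> Finj p s sP _.
have id_nat q r (qr : (q <= r)%O) x :
    (idfun : {additive F r -> F r}) (farr F qr x) = farr F qr (idfun x) by [].
have [g gK] := Finj _ _ _ (NatTrans (ncomp := fun q => idfun) id_nat) (@env_emb_mono _ _ F).
have [||y _ yP] := @cofree_extensible (fun q => inj_hull (F q)) p (fun q => env_emb F q (s q)).
- by move=> q r qr pq; rewrite -naturality sP.
- by [].
by exists (g p y) => // q pq p_lt_q; rewrite -naturality yP // gK.
Qed.

Hypothesis wfC : well_founded (fun q p : C => (p < q)%O).

(** The lift is built by recursion from the top. At [p], a preimage [b] of [s p] differs from the
    lift already built above [p] by a section of the kernel; extending this error to [p] corrects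
    [b]. *)
Lemma lift_section F G (f : nattrans F G) (U : set C) (s : dprod G) :
    extensible (fun p => [set x | f p x = 0]) ->
    (forall p q, (p <= q)%O -> U p -> U q) ->
    section_over U s -> (forall p, U p -> exists x, f p x = s p) ->
  exists2 t : dprod F, section_over U t & forall p, U p -> f p (t p) = s p.
Proof.
move=> fext Uup sP sf.
pose good p (t : forall q, (p < q)%O -> F q) : set (F p) :=
  [set y | f p y = s p /\ forall q (pq : (p < q)%O), farr F (ltW pq) y = t q pq].
pose step p t : F p := xget 0 (@good p t).
pose t : dprod F := Fix wfC (fun p => F p) step.
have tE p : t p = xget 0 (@good p (fun q _ => t q)).
  rewrite [LHS]Fix_eq // => q u v uv; congr (step q _).
  by apply: functional_extensionality_dep => r; apply: functional_extensionality_dep.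
have good_farr p q (pq : (p <= q)%O) :
    @good p (fun r _ => t r) (t p) -> farr F pq (t p) = t q.
  case=> _ tp; have := pq; rewrite le_eqVlt => /predU1P[pq_eq|lt_pq].
    by case: _ / pq_eq pq => pp; apply: farr_id.
  by rewrite -(tp q lt_pq) (bool_irrelevance pq (ltW lt_pq)).
have tP p : U p -> @good p (fun q _ => t q) (t p).
  elim/(well_founded_ind wfC): p => p IH Up; rewrite tE; apply: xgetPex.
  have [b fb] := sf p Up.
  (* The error of [b], meaningful only on the objects above [p]. *)
  pose e : dprod F := fun q =>
    if boolP (p <= q)%O is AltTrue pq then farr F pq b - t q else 0.
  have eE q (pq : (p <= q)%O) : e q = farr F pq b - t q.
    rewrite /e; case: {-}_ / boolP => [pq'|/negP//].
    by rewrite (bool_irrelevance pq' pq).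
  have [||y fy yP] := fext p e.
  - move=> q r qr pq; rewrite (eE q (ltW pq)) (eE r (le_trans (ltW pq) qr)).
    rewrite raddfB -(farr_comp (ltW pq) qr (le_trans (ltW pq) qr)); suff -> : farr F qr (t q) = t r by [].
    by apply: good_farr; apply: IH (Uup _ _ (ltW pq) Up).
  - move=> q pq /=; rewrite (eE q (ltW pq)) raddfB naturality fb sP //.
    by have [-> _] := IH q pq (Uup _ _ (ltW pq) Up); rewrite subrr.
  exists (b - y); split=> [|q pq]; first by rewrite raddfB fb fy subr0.
  by rewrite raddfB yP // (eE q (ltW pq)) subKr.
by exists t => [q r qr /tP/good_farr|p /tP[]].
Qed.

(** By exactness each kernel is the image of the preceding map. A section of it is lifted along that
    map, the lift is extended in the source, and the extension is pushed forward. *)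
Lemma resolution_extensible H (R : injective_resolution H) n :
    extensible (F := H) (fun=> setT) ->
  extensible (fun p => [set x | res_d R n p x = 0]).
Proof.
move=> Hext; elim: n => [|n IHn] p s sP sK.
  pose h : dprod H := fun q => xget 0 [set x | res_aug R q x = s q].
  have hP q : (p < q)%O -> res_aug R q (h q) = s q.
    by move=> /sK /res_exact0; apply: xgetPex.
  have [||y _ yP] := Hext p h.
  - move=> q r qr pq; apply: (@res_mono _ _ _ R).
    by rewrite naturality !hP ?sP //; apply: lt_le_trans qr.
  - by [].
  exists (res_aug R p y) => [|q pq p_lt_q]; first by apply/res_exact0; exists y.
  by rewrite -naturality yP ?hP.
have [|||t tP ft] := lift_section (s := s) IHn (U := above p).
- by move=> q r qr /= pq; apply: lt_le_trans qr.
- exact: sP.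
- by move=> q /sK /res_exact.
have [//|y _ yP] := injective_extensible (@res_injective _ _ _ R n) tP.
exists (res_d R n p y) => [|q pq p_lt_q]; first by apply/res_exact; exists y.
by rewrite -naturality yP ?ft.
Qed.

(** A cocycle is a global section of a kernel, hence locally in the image of the preceding
    differential; lifting it over all of [C] makes it a coboundary. *)
Lemma extensible_acyclic H : extensible (F := H) (fun=> setT) -> lim_acyclic H.
Proof.
move=> Hext R [//|n] _ x; rewrite -[x]reprK; set c := repr x.
have /eqP c0 : limit_map (res_d R n.+1) (val c) == 0 := valP c.
have dc p : res_d R n.+1 p (val (val c) p) = 0.
  exact: (congr1 (fun y : limit _ => val y p) c0).
have cP q r (qr : (q <= r)%O) : farr _ qr (val (val c) q) = val (val c) r.
  by have := valP (val c); rewrite unfold_in => /asboolP ->.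
have [|||t tP ft] := lift_section (s := val (val c)) (resolution_extensible (R := R) (n := n) Hext) (U := setT).
- by [].
- by move=> q r qr _; apply: cP.
- by move=> p _; apply/res_exact.
have t_compat : t \in @compatible _ C (res_obj R n).
  by rewrite unfold_in; apply/asboolP => p q pq; apply: tP.
pose w : limit (res_obj R n) := exist _ t t_compat.
have -> : 0 = (\pi_(derived_limit R n.+1) 0)%qT by rewrite !piE.
apply/eqP; rewrite -[X in is_true X]/(_ == _ %[mod derived_limit R n.+1])%qT.
rewrite -Quotient.idealrBE subr0; apply/asboolP; exists w.
by apply: val_inj => /=; apply: functional_extensionality_dep => p; apply: ft.
Qed.

End Extension.

Section PseudoInjective.
Context d (C : porderType d) (deg : C -> int).
Hypotheses (Cgraded : graded deg) (Cbounded : bounded_above deg).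

Lemma bounded_above_wf : well_founded (fun q p : C => (p < q)%O).
Proof.
have [N degN] := Cbounded.
(* [N - deg p] is nonnegative and decreases as [p] goes up. *)
suff acc n p : N - deg p < n%:Z -> Acc (fun q p : C => (p < q)%O) p.
  by move=> p; apply: (acc `|N - deg p|.+1%N); have := degN p; lia.
elim: n p => [|n IHn] p; first by have := degN p; lia.
by move=> pn; constructor=> q /(proj1 Cgraded) pq; apply: IHn; lia.
Qed.

(** Bisection at an object strictly between [p] and [r]; if there is none, the degrees are
    consecutive and [m] is one of them. *)
Lemma graded_interpolation (p r : C) (m : int) : (p <= r)%O ->
    deg p <= m <= deg r ->
  exists2 q : C, (p <= q <= r)%O & deg q = m.
Proof.
have [degS degP] := Cgraded.
have [n] := ubnP `|deg r - deg p|%N; elim: n => // n IHn in p r *.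
move=> le_n pr /andP[pm mr].
have [<-|pm'] := eqVneq (deg p) m; first by exists p; rewrite ?lexx.
have [<-|mr'] := eqVneq (deg r) m; first by exists r; rewrite ?lexx ?pr.
have {}pr : (p < r)%O.
  by rewrite lt_neqAle pr andbT; apply: contra_neqN pm' => /eqP pr'; subst r; lia.
have [u /andP[pu ur]] : exists u, (p < u < r)%O.
  apply: contrapT => nou; suff /degP : precedes p r by lia.
  split=> // u pu ur; apply: contrapT => /not_orP[/eqP up /eqP ur'].
  by apply: nou; exists u; rewrite !lt_neqAle eq_sym up pu ur' ur.
have := degS _ _ pu; have := degS _ _ ur => dur dpu.
have [mu|um] := leP m (deg u).
  have [|||q /andP[pq qu] qm] := IHn p u; rewrite ?(ltW pu) ?pm ?mu //; first lia.
  by exists q; rewrite // pq (le_trans qu (ltW ur)).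
have [|||q /andP[uq qr] qm] := IHn u r; rewrite ?(ltW ur) ?mr ?(ltW um) //; first lia.
by exists q; rewrite // qr (le_trans (ltW pu) uq).
Qed.

Lemma pseudo_injective_extensible (H : abfunctor C) : pseudo_injective deg H ->
  extensible (F := H) (fun=> setT).
Proof.
have [degS _] := Cgraded; have [N degN] := Cbounded.
move=> Hpi p s sP _.
suff match_deg k : exists y : H p, forall q (pq : (p <= q)%O), (p < q)%O ->
    N - k%:Z < deg q -> farr H pq y = s q.
  have [y yP] := match_deg `|N - deg p|%N; exists y => // q pq p_lt_q.
  by apply: yP => //; have := degS _ _ p_lt_q; have := degN p; lia.
elim: k => [|k [y yP]].
  by exists 0 => q pq _; have := degN q; lia.
pose m := N - k%:Z.
(* At or below the degree of [p] there is nothing new to match. *)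
have [mp|pm] := leP m (deg p).
  exists y => q pq p_lt_q _; apply: yP => //.
  by have := degS _ _ p_lt_q; move: mp; rewrite /m; lia.
pose J := {q : C | (p < q)%O && (deg q == m)}.
have pJ (j : J) : (p < sval j)%O by case: j => q /= /andP[].
have degJ (j : J) : deg (sval j) = m by case: j => q /= /andP[_ /eqP].
(* Strictly above [sval j] degrees exceed [m], where [y] already matches [s]. *)
have Ksy (j : J) : Ker (s (sval j) - farr H (ltW (pJ j)) y).
  move=> r jr rj; have jr' : (sval j < r)%O by rewrite lt_neqAle eq_sym rj.
  rewrite raddfB -(farr_comp _ _ (le_trans (ltW (pJ j)) jr)) (sP _ _ jr (pJ j)) yP ?subrr //.
    exact: lt_trans jr'.
  by have := degS _ _ jr'; rewrite degJ.
have [y' y'P] := Hpi `|m - deg p|%N p J sval (fun j => ltW (pJ j)) _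
  val_inj (fun j => congr1 (fun n => `|n - deg p|%N) (degJ j)) Ksy.
exists (y + y') => q pq p_lt_q mq; rewrite raddfD.
have [qm|mq'] := eqVneq (deg q) m.
  have Jq : (p < q)%O && (deg q == m) by rewrite p_lt_q qm eqxx.
  have := y'P (exist _ q Jq) => /=.
  by rewrite (bool_irrelevance (ltW _) pq) => ->; rewrite addrC subrK.
rewrite yP //; last by rewrite -/m; move: mq mq'; rewrite /m; lia.
have {mq mq'}mq : m < deg q by move: mq mq'; rewrite /m; lia.
(* The arrow to [q] factors through some [r] of degree [m], where [y'] maps into [Ker]. *)
have [||r /andP[pr rq] rm] := @graded_interpolation p q m; rewrite ?(ltW pm) ?(ltW mq) //.
have lt_pr : (p < r)%O.
  by rewrite lt_neqAle pr andbT; apply: contraTneq pm => ->; rewrite rm ltxx.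
have Jr : (p < r)%O && (deg r == m) by rewrite lt_pr rm eqxx.
pose j : J := exist _ r Jr.
rewrite (farr_comp (ltW (pJ j)) rq) y'P Ksy ?addr0 //=.
by apply: contraTneq mq => ->; rewrite rm ltxx.
Qed.

End PseudoInjective.

Theorem theorem14 (d : Order.disp_t) (C : porderType d) (deg : C -> int)
  (H : abfunctor C) (Cgraded : graded deg) (Cbounded : bounded_above deg)
  (Hpi : pseudo_injective deg H) : lim_acyclic H.
Proof.
exact: (extensible_acyclic (bounded_above_wf Cgraded Cbounded)
  (pseudo_injective_extensible Cgraded Cbounded Hpi)).
Qed.
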